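(* Let $\mathcal H=(V,\mathcal E)$ be a Steiner system (a $2$-$(n,k,1)$ design with $2\le k\le n$). The following are equivalent: (i) $f_{\mathcal H}$ is join-irreducible; (ii) $\mathcal H_e\cong\mathcal H_{e'}$ for all $e,e'\in[V]^2$; (iii) $\mathcal H$ is $-2$-monomorphic.
   Context: A hypergraph $\mathcal H=(V,\mathcal E)$ consists of a finite nonempty set $V=\{1,\dots,n\}$ and a collection $\mathcal E$ of subsets of $V$; $f_{\mathcal H}\colon\{0,1\}^n\to\{0,1\}$ is the function computed by the $GF(2)$ polynomial $\sum_{E\in\mathcal E}\prod_{i\in E}x_i$. $[V]^m$ denotes the set of $m$-element subsets of $V$. $\mathcal H$ is a $2$-$(n,k,\lambda)$ design if $|V|=n$, $\mathcal E\subseteq[V]^k$ and every $e\in[V]^2$ is contained in exactly $\lambda$ hyperedges; it is a Steiner system if $\lambda=1$. Hypergraphs $(V,\mathcal E)$, $(V',\mathcal E')$ are isomorphic ($\cong$) if there is a bijection $\varphi\colon V\to V'$ with $E\in\mathcal E\iff\varphi(E)\in\mathcal E'$. For $e=\{i,j\}\in[V]^2$ and a new element $l_e\notin V$, let $h\colon V\to V_e=(V\setminus e)\cup\{l_e\}$ map $i,j$ to $l_e$ and fix all other vertices; $\mathcal H_e=(V_e,\mathcal E_e)$ where $E\in\mathcal E_e$ iff the number of $E'\in\mathcal E$ with $h(E')=E$ is odd. Let $\mathcal H_{-e}$ be the induced hypergraph $(V\setminus e,\{E\in\mathcal E:E\subseteq V\setminus e\})$; $\mathcal H$ is $-2$-monomorphic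 if $\mathcal H_{-e}\cong\mathcal H_{-e'}$ for all $e,e'\in[V]^2$. Simple minor order on Boolean functions: $g\le f$ if there is $\sigma$ with $g(a_1,\dots,a_m)=f(a_{\sigma(1)},\dots,a_{\sigma(n)})$ for all $a_i$; $g<f$ if $g\le f$, $f\not\le g$. $f$ is join-irreducible if there is $f'<f$ such that every $g<f$ satisfies $g\le f'$. *)

(* Defs.v *)
From HB Require Import structures.
From mathcomp Require Import all_boot all_order all_algebra.

Set Implicit Arguments.
Unset Strict Implicit.
Unset Printing Implicit Defensive.

(* A hypergraph on the vertex type V is identified with its set of hyperedges. *)
Notation hypergraph V := {set {set V}}.

Notation boolfun n := ({ffun 'I_n -> bool} -> bool).

(* The ring structure on bool is the field GF(2): addition is addb and
   multiplication is andb. *)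
Definition hyper_fun (n : nat) (H : hypergraph 'I_n) : boolfun n :=
  fun x => (\sum_(E in H) \prod_(i in E) x i)%R.

Definition minor (m n : nat) (g : boolfun m) (f : boolfun n) : Prop :=
  exists sigma : 'I_n -> 'I_m,
    forall a : {ffun 'I_m -> bool}, g a = f [ffun i => a (sigma i)].

Definition strict_minor (m n : nat) (g : boolfun m) (f : boolfun n) : Prop :=
  minor g f /\ ~ minor f g.

(* Boolean functions have positive arity. *)
Definition join_irreducible (n : nat) (f : boolfun n) : Prop :=
  exists (m : nat) (f' : boolfun m),
    [/\ 0 < m, strict_minor f' f &
        forall (p : nat) (g : boolfun p),
          0 < p -> strict_minor g f -> minor g f'].

Definition design2 (V : finType) (n k lambda : nat) (H : hypergraph V) : Prop :=
  [/\ #|V| = n,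
      forall E : {set V}, E \in H -> #|E| = k &
      forall e : {set V}, #|e| = 2 -> #|[set E in H | e \subset E]| = lambda].

Definition steiner_system (V : finType) (n k : nat) (H : hypergraph V) : Prop :=
  design2 n k 1 H.

Definition hyper_iso (V W : finType) (H : hypergraph V) (K : hypergraph W) : Prop :=
  exists phi : V -> W,
    bijective phi /\ forall E : {set V}, E \in H <-> phi @: E \in K.

Definition outside (V : finType) (e : {set V}) : finType := {x : V | x \notin e}.

(* option (outside e) is V_e, with None as the new vertex l_e: insub sends the
   vertices of e to None and every other vertex x to Some x. *)
Definition merge (V : finType) (e : {set V}) (x : V) : option (outside e) := insub x.

Definition merge_hyper (V : finType) (e : {set V}) (H : hypergraph V) :
    hypergraph (option (outside e)) :=
  [set E | odd #|[set E' in H | merge e @: E' == E]|].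

(* The hyperedges of H disjoint from e, as sets of elements of outside e. *)
Definition delete_hyper (V : finType) (e : {set V}) (H : hypergraph V) :
    hypergraph (outside e) :=
  [set F : {set outside e} | [set val x | x in F] \in H].

Definition minus2_monomorphic (V : finType) (H : hypergraph V) : Prop :=
  forall e e' : {set V}, #|e| = 2 -> #|e'| = 2 ->
    hyper_iso (delete_hyper e H) (delete_hyper e' H).

(* Main.v *)
(** Write [f_H] for the function of the hypergraph [H].  A map [rho : V -> W] of
    variables sends [f_H] to the function of a pushed-forward hypergraph, whose edges
    are the images [rho @: E] counted modulo 2; by uniqueness of the Zhegalkin
    polynomial this determines the hypergraph.  Every strict minor of [f_H]
    identifies two variables, hence is a minor of some [f_{H_e}], so if all [H_e] are
    isomorphic then [f_{H_e}] is the largest strict minor.  Conversely, when [k > 2]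
    distinct blocks stay distinct in [H_e], every vertex of [H_e] lies on an edge,
    and a minor relation between two [f_{H_e}] is induced by a bijection.

    For [k > 2], [H_{-e}] determines [H_e]: the edges through the new vertex [l_e]
    are the sets [F + l_e] where [F] is maximal among the sets that meet each edge of
    [H_{-e}] in at most one point.  For [2 < k < n], [H_e] determines [l_e], hence
    [H_{-e}]: the pairs lying on two edges of [H_e] all contain [l_e], and there are
    at least two of them.  If [k = 2] or [k = n], every [k]-subset is a block and all
    permutations of the points are automorphisms. *)

From Pilot Require Import Defs.
From HB Require Import structures.
From mathcomp Require Import all_boot all_order all_algebra.
From mathcomp Require Import fingroup perm.
(* so that [merge] is not path.merge *)
Import Pilot.Defs.

Set Implicit Arguments.
Unset Strict Implicit.
Unset Printing Implicit Defensive.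

(** * Pushforward of hypergraphs and the functions they compute *)

Section Pushforward.

Implicit Types V W U : finType.

Definition hypergraph_fun V (H : hypergraph V) (a : V -> bool) : bool :=
  odd #|[set E in H | E \subset [pred x | a x]]|.

Lemma hyper_funE n (H : hypergraph 'I_n) x : hyper_fun H x = hypergraph_fun H x.
Proof.
rewrite /hyper_fun /hypergraph_fun -sum1_card.
rewrite (big_morph odd oddD (erefl : odd 0 = false)) /=.
under [RHS]eq_bigl => E do rewrite inE.
rewrite big_mkcondr /=; apply: eq_bigr => E _.
case: ifP => [sE|/negbT/subsetPn[i iE /negbTE xi]].
  by rewrite big1 // => i /(subsetP sE).
by rewrite (bigD1 i) //=; move: xi; rewrite inE => ->; rewrite GRing.mul0r.
Qed.

Lemma eq_hypergraph_fun V (H : hypergraph V) a b :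
  a =1 b -> hypergraph_fun H a = hypergraph_fun H b.
Proof.
move=> ab; rewrite /hypergraph_fun; congr odd; apply: eq_card => E.
by rewrite !inE; congr (_ && _); apply: eq_subset_r => x; rewrite !inE ab.
Qed.

(* Uniqueness of the Zhegalkin polynomial: the value at the indicator of E
   determines the parity of the number of hyperedges contained in E. *)
Lemma hypergraph_fun_inj V (H K : hypergraph V) :
  hypergraph_fun H =1 hypergraph_fun K -> H = K.
Proof.
move=> eqHK; apply/setP => E; have [m] := ubnP #|E|.
elim: m E => // m IHm E leEm.
have split (L : hypergraph V) : hypergraph_fun L (mem E) =
    (E \in L) (+) odd #|[set F in L | F \proper E]|.
  rewrite /hypergraph_fun (cardsD1 E) oddD !inE subxx andbT oddb.
  congr (_ (+) odd _); apply: eq_card => F.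
  by rewrite !inE properEneq andbCA.
have := eqHK (mem E); rewrite !split.
have -> : [set F in H | F \proper E] = [set F in K | F \proper E].
  apply/setP => F; rewrite !inE andbC [RHS]andbC.
  case pF: (F \proper E) => //=; apply: IHm.
  exact: leq_trans (proper_card pF) _.
exact: addIb.
Qed.

(* For [rho = merge e] this is convertible to [merge_hyper e H]. *)
Definition push V W (rho : V -> W) (H : hypergraph V) : hypergraph W :=
  [set E | odd #|[set F in H | rho @: F == E]|].

(** Group the edges [F] of [H] by their image: [F] lies in the preimage of [a] iff [rho @: F] lies
    in [a], and the parity of each group is membership in [push rho H]. *)
Lemma hypergraph_fun_push V W (rho : V -> W) (H : hypergraph V) a :
  hypergraph_fun (push rho H) a = hypergraph_fun H (a \o rho).
Proof.
rewrite /hypergraph_fun.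
rewrite -sum1_card (big_morph odd oddD (erefl : odd 0 = false)) /=.
under eq_bigl => E do rewrite inE andbC.
rewrite big_mkcondr /= -[in RHS]sum1_card.
rewrite (partition_big (fun F : {set V} => rho @: F)
  (fun E : {set W} => E \subset [pred x | a x])) /=; last first.
  move=> F; rewrite inE => /andP[_ sF].
  by apply/subsetP => _ /imsetP[x xF ->]; have := subsetP sF x xF.
rewrite (big_morph odd oddD (erefl : odd 0 = false)).
apply: eq_bigr => E sE; rewrite sum1_card inE.
transitivity (odd #|[set F in H | rho @: F == E]|); first by case: ifP.
congr odd; apply: eq_card => F; rewrite !inE [RHS]unfold_in inE -andbA.
congr (_ && _); apply/eqP/andP => [rF | [_ /eqP//]]; split; last exact/eqP.
apply/subsetP => x xF; have /(subsetP sE) : rho x \in E by rewrite -rF imset_f.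
by [].
Qed.

Lemma eq_push V W (rho sigma : V -> W) (H : hypergraph V) :
  rho =1 sigma -> push rho H = push sigma H.
Proof.
move=> rs; apply/setP => E; rewrite !inE; congr odd; apply: eq_card => F.
by rewrite !inE (eq_imset _ rs).
Qed.

(** Uniqueness of the polynomial replaces a count of iterated fibres modulo 2. *)
Lemma push_comp V W U (rho : W -> U) (sigma : V -> W) (H : hypergraph V) :
  push (rho \o sigma) H = push rho (push sigma H).
Proof. by apply: hypergraph_fun_inj => a; rewrite !hypergraph_fun_push. Qed.

Lemma push_id V (H : hypergraph V) : push id H = H.
Proof. by apply: hypergraph_fun_inj => a; rewrite hypergraph_fun_push. Qed.

Lemma push_edge V W (rho : V -> W) (H : hypergraph V) E :
  E \in push rho H -> exists2 F, F \in H & E = rho @: F.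
Proof.
rewrite inE; case: (set_0Vmem [set F in H | rho @: F == E]) => [->|[F]].
  by rewrite cards0.
by rewrite inE => /andP[FH /eqP <-] _; exists F.
Qed.

Lemma push_inj_in V W (rho : V -> W) (H : hypergraph V) :
  {in H &, injective (fun F : {set V} => rho @: F)} ->
  push rho H = [set rho @: F | F : {set V} in H].
Proof.
move=> injr; apply/setP => E; apply/idP/imsetP => [/push_edge //|[F FH ->]].
rewrite inE (_ : [set _ in _ | _] = [set F]) ?cards1 //.
apply/setP => F'; rewrite !inE; apply/andP/eqP => [[F'H /eqP]|->//].
exact: injr.
Qed.

(** This form lets isomorphisms compose by [push_comp] and links them to minors through
    [hypergraph_fun_push]. *)
Lemma hyper_isoP V W (H : hypergraph V) (K : hypergraph W) :
  hyper_iso H K <-> exists2 phi : V -> W, bijective phi & push phi H = K.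
Proof.
have memE (phi : V -> W) (bphi : bijective phi) (E : {set V}) :
    (phi @: E \in push phi H) = (E \in H).
  have inj := imset_inj (bij_inj bphi).
  by rewrite push_inj_in ?mem_imset // => A B _ _ /inj.
split=> [[phi [bphi isoE]]|[phi bphi <-]]; exists phi => //; last first.
  by split=> // E; rewrite memE.
have [psi _ psiK] := bphi.
apply/setP => E; have -> : E = phi @: (psi @: E).
  by rewrite -imset_comp -[LHS]imset_id; apply: eq_imset => x /=.
by rewrite memE //; apply/idP/idP => /isoE.
Qed.

Lemma hyper_iso_sym V W (H : hypergraph V) (K : hypergraph W) :
  hyper_iso H K -> hyper_iso K H.
Proof.
move=> /hyper_isoP[phi [psi phiK psiK] <-]; apply/hyper_isoP; exists psi.
  by exists phi.
by rewrite -push_comp -[RHS]push_id; apply: eq_push => x /=.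
Qed.

Lemma hyper_iso_trans V W U (H : hypergraph V) (K : hypergraph W)
  (L : hypergraph U) : hyper_iso H K -> hyper_iso K L -> hyper_iso H L.
Proof.
move=> /hyper_isoP[phi bphi <-] /hyper_isoP[psi bpsi <-]; apply/hyper_isoP.
by exists (psi \o phi); [exact: bij_comp | rewrite push_comp].
Qed.

End Pushforward.

(** * Merging and deleting a pair of vertices *)

Section MergeDelete.

Variables (V : finType).
Implicit Types (H : hypergraph V) (e E : {set V}).

Lemma card_option_outside e : #|e| = 2 -> #|{: option (outside e)}| = #|V|.-1.
Proof.
move=> e2; rewrite card_option card_sig -(cardC (mem e)) e2.
by congr _.+1; apply: eq_card => x; rewrite !inE.
Qed.

Lemma card2P e : #|e| = 2 -> exists i j, i != j /\ e = [set i; j].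
Proof. by move=> /eqP/cards2P[i [j [ij ->]]]; exists i, j. Qed.

Lemma merge_in e x : x \in e -> merge e x = None.
Proof. by move=> xe; rewrite /merge insubN ?negbK. Qed.

Lemma merge_val e (x : outside e) : merge e (val x) = Some x.
Proof. exact: valK. Qed.

Lemma merge_eq_Some e x y : (merge e x == Some y) = (x == val y).
Proof.
apply/eqP/eqP => [|->]; last exact: merge_val.
by rewrite /merge; case: insubP => // u _ <- [->].
Qed.

Lemma merge_eq_None e x : (merge e x == None) = (x \in e).
Proof.
rewrite /merge; case: insubP => [u /negbTE -> _ //|].
by rewrite negbK => ->.
Qed.

Lemma mem_merge_Some e E y : (Some y \in merge e @: E) = (val y \in E).
Proof.
apply/imsetP/idP => [[x xE /esym/eqP]|yE].
  by rewrite merge_eq_Some => /eqP <-.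
by exists (val y); rewrite ?merge_val.
Qed.

Lemma mem_merge_None e E : (None \in merge e @: E) = ~~ [disjoint e & E].
Proof.
rewrite disjoint_sym; apply/imsetP/pred0Pn => [[x xE /esym/eqP]|[x /andP[xE xe]]].
  by rewrite merge_eq_None => xe; exists x; apply/andP.
by exists x; rewrite ?merge_in.
Qed.

(** Nothing cancels modulo 2 away from the new vertex: the only set merged to [Some @: F] is
    [val @: F]. So the edges of [H_{-e}] are those of [H_e] avoiding [None]. *)
Lemma mem_delete e H (F : {set outside e}) :
  (F \in delete_hyper e H) = (Some @: F \in merge_hyper e H).
Proof.
rewrite !inE.
have eqF E : (merge e @: E == Some @: F) = (E == val @: F).
  apply/eqP/eqP => [eqE|->]; last first.
    by rewrite -imset_comp; apply: eq_imset => x; exact: merge_val.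
  have dE : [disjoint e & E].
    by rewrite -[[disjoint _ & _]]negbK -mem_merge_None eqE; apply/imsetP => -[].
  apply/setP => x; apply/idP/imsetP => [xE|[y yF ->]].
    have xe : x \notin e by apply: contraTN xE => xe; rewrite (disjointFr dE xe).
    exists (Sub x xe); last by rewrite SubK.
    by rewrite -(mem_imset _ _ Some_inj) -eqE mem_merge_Some SubK.
  by rewrite -mem_merge_Some eqE mem_imset //; exact: Some_inj.
rewrite (_ : [set E in H | _] = if val @: F \in H then [set val @: F] else set0).
  by case: ifP; rewrite ?cards1 ?cards0.
apply/setP => E; rewrite inE eqF; case: ifP => FH; rewrite !inE; last first.
  by apply/negP => /andP[EH /eqP eE]; rewrite -eE EH in FH.
by rewrite andb_idl // => /eqP ->.
Qed.


Lemma set_option_cases (T : finType) (E : {set option T}) :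
  exists F : {set T}, E = Some @: F \/ E = None |: Some @: F.
Proof.
exists [set x | Some x \in E].
have memS x : (Some x \in Some @: [set x | Some x \in E]) = (Some x \in E).
  by rewrite mem_imset ?inE //; exact: Some_inj.
have memN : None \in Some @: [set x | Some x \in E] = false.
  by apply/imsetP => -[].
case NE: (None \in E); [right|left]; apply/setP => -[x|];
  by rewrite ?in_setU ?in_set1 ?memS ?memN ?NE.
Qed.

Lemma omap_bij (T U : finType) (psi : T -> U) :
  bijective psi -> bijective (omap psi).
Proof.
by case=> psi' K K'; exists (omap psi') => -[x|] //=; rewrite ?K ?K'.
Qed.

Lemma omap_imset_Some (T U : finType) (psi : T -> U) (F : {set T}) :
  omap psi @: (Some @: F) = Some @: (psi @: F).
Proof. by rewrite -!imset_comp; apply: eq_imset. Qed.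

Lemma omap_imset_None (T U : finType) (psi : T -> U) (F : {set T}) :
  omap psi @: (None |: Some @: F) = None |: Some @: (psi @: F).
Proof. by rewrite imsetU1 omap_imset_Some. Qed.

Lemma delete_iso H e e' (phi : option (outside e) -> option (outside e')) :
  bijective phi -> phi None = None ->
  (forall E : {set option (outside e)},
     E \in merge_hyper e H <-> phi @: E \in merge_hyper e' H) ->
  hyper_iso (delete_hyper e H) (delete_hyper e' H).
Proof.
move=> bphi phiN isoE.
have psiP x : {y | phi (Some x) = Some y}.
  case phix: (phi (Some x)) => [y|]; first by exists y.
  by have := bij_inj bphi (etrans phix (esym phiN)).
pose psi x := sval (psiP x).
have psiE x : phi (Some x) = Some (psi x) by exact: svalP (psiP x).
exists psi; split=> [|F]; last first.
  rewrite !mem_delete -(_ : phi @: (Some @: F) = Some @: (psi @: F)) //.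
  by rewrite -!imset_comp; apply: eq_imset.
have [phi' phiK phi'K] := bphi.
have phi'N : phi' None = None by rewrite -phiN phiK.
have psi'P y : {x | phi' (Some y) = Some x}.
  case phix: (phi' (Some y)) => [x|]; first by exists x.
  by have := can_inj phi'K (etrans phix (esym phi'N)).
exists (fun y => sval (psi'P y)) => [x|y]; apply: Some_inj.
  by rewrite -(svalP (psi'P _)) -psiE phiK.
by rewrite -psiE -(svalP (psi'P _)) phi'K.
Qed.

Lemma perm_card2 e e' :
  #|e| = 2 -> #|e'| = 2 -> exists s : {perm V}, s @: e = e'.
Proof.
move=> /card2P[i [j [ij ->]]] /card2P[i' [j' [i'j' ->]]].
(* The second transposition fixes [i'], since [t j] and [j'] both differ from it. *)
pose t := tperm i i'; exists (t * tperm (t j) j')%g.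
rewrite imsetU1 imset_set1 !permM tpermL; congr [set _; _].
rewrite [t i]tpermL tpermD // 1?eq_sym //.
by rewrite -(tpermL i i') (inj_eq perm_inj).
Qed.

(** A permutation [s] taking [e] to [e'] induces [omap psi] with
    [omap psi \o merge e =1 merge e' \o s]. Pushing [H] along both sides gives the first
    isomorphism; it fixes [None], hence restricts to the second. *)
Lemma symmetric_iso H e e' :
  (forall (s : {perm V}) E, (s @: E \in H) = (E \in H)) ->
  #|e| = 2 -> #|e'| = 2 ->
  hyper_iso (merge_hyper e H) (merge_hyper e' H) /\
  hyper_iso (delete_hyper e H) (delete_hyper e' H).
Proof.
move=> symH e2 e'2; have [s se] := perm_card2 e2 e'2.
have out (x : outside e) : s (val x) \notin e'.
  by rewrite -se mem_imset ?(valP x) //; exact: perm_inj.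
pose psi x : outside e' := Sub (s (val x)) (out x).
have psi_inj : injective psi.
  by move=> x y /(congr1 val); rewrite !SubK => /perm_inj/val_inj.
have bphi : bijective (omap psi).
  apply: inj_card_bij; last by rewrite !card_option_outside.
  by move=> [x|] [y|] // /Some_inj/psi_inj ->.
have pushs : push s H = H.
  have inj : injective (fun F : {set V} => s @: F) by apply: imset_inj; exact: perm_inj.
  rewrite push_inj_in; last by move=> A B _ _ /inj.
  apply/setP => E; apply/imsetP/idP => [[F FH ->]|EH]; first by rewrite symH.
  have sK : E = s @: (s^-1%g @: E).
    by rewrite -imset_comp -[LHS]imset_id; apply: eq_imset => x /=; rewrite permKV.
  by exists (s^-1%g @: E); rewrite // -(symH s) -sK.
have isoM : push (omap psi) (merge_hyper e H) = merge_hyper e' H.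
  rewrite -[merge_hyper e H]/(push (merge e) H).
  rewrite -[merge_hyper e' H]/(push (merge e') H) -[in RHS]pushs -!push_comp.
  apply: eq_push => x /=; apply/esym/eqP.
  case xe: (x \in e); first by rewrite (merge_in xe) /= merge_eq_None -se imset_f.
  have -> : x = val (Sub x (negbT xe) : outside e) by rewrite SubK.
  by rewrite merge_val /= merge_eq_Some SubK.
have isoH : hyper_iso (merge_hyper e H) (merge_hyper e' H).
  by apply/hyper_isoP; exists (omap psi).
split=> //; apply: (@delete_iso _ _ _ (omap psi)) => // E.
rewrite -isoM push_inj_in ?mem_imset //; last first.
- by move=> A B _ _ /(imset_inj (bij_inj bphi)).
- exact/imset_inj/bij_inj.
Qed.

End MergeDelete.

(** * Sets meeting every edge in at most one point *)

Section Scattered.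

Implicit Types V W : finType.

(** These are the strongly independent sets of [K]. *)
Definition scattered V (K : hypergraph V) (F : {set V}) :=
  forall (E : {set V}) x y, E \in K -> x \in F -> y \in F -> x \in E -> y \in E -> x = y.

Definition max_scattered V (K : hypergraph V) (F : {set V}) :=
  scattered K F /\ forall F' : {set V}, F \subset F' -> scattered K F' -> F' \subset F.

Lemma max_scattered_iso V W (K : hypergraph V) (L : hypergraph W)
  (phi : V -> W) (F : {set V}) :
  bijective phi -> (forall E : {set V}, E \in K <-> phi @: E \in L) ->
  max_scattered K F <-> max_scattered L (phi @: F).
Proof.
move=> bphi isoE; have inj := bij_inj bphi; have [psi phiK psiK] := bphi.
have im (E : {set W}) : E = phi @: (psi @: E).
  by rewrite -imset_comp -[LHS]imset_id; apply: eq_imset => x /=.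
have sc G : scattered K G <-> scattered L (phi @: G).
  split=> scG E x y.
    rewrite [E]im => /isoE EK /imsetP[x' xG ->] /imsetP[y' yG ->].
    rewrite !mem_imset // => xE yE; congr phi; exact: scG EK xG yG xE yE.
  move=> /isoE EL xG yG xE yE; apply: (inj).
  by apply: (scG _ _ _ EL); rewrite mem_imset.
split=> -[scF maxF]; split; try exact/sc; move=> F'.
  rewrite [F']im => sF /sc scF'; apply: imsetS; apply: maxF scF'.
  apply/subsetP => x xF; have := subsetP sF (phi x).
  by rewrite !mem_imset // => ->.
move=> sF /sc scF'; apply/subsetP => x xF'.
have /subsetP/(_ (phi x)) := maxF _ (imsetS phi sF) scF'.
by rewrite !mem_imset // => ->.
Qed.

End Scattered.

(** * Blocks of a Steiner system *)

Section SteinerSystem.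

Variables (V : finType) (n k : nat) (H : hypergraph V).
Hypothesis stH : steiner_system n k H.
Implicit Types e E : {set V}.

Lemma block_exists x y : x != y -> exists E, [/\ E \in H, x \in E & y \in E].
Proof.
move=> xy; have [_ _ /(_ [set x; y])] := stH; rewrite cards2 xy => /(_ erefl).
move=> /eqP/cards1P[E /setP/(_ E)]; rewrite !inE eqxx subUset !sub1set.
by case/and3P=> *; exists E.
Qed.

Lemma block_unique x y E E' : x != y -> E \in H -> E' \in H ->
  x \in E -> y \in E -> x \in E' -> y \in E' -> E = E'.
Proof.
move=> xy EH E'H xE yE xE' yE'; have [_ _ /(_ [set x; y])] := stH.
rewrite cards2 xy => /(_ erefl)/eqP/cards1P[B /setP eqB].
have := eqB E; have := eqB E'; rewrite !inE !subUset !sub1set.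
by rewrite EH E'H xE yE xE' yE' => /esym/eqP -> /esym/eqP ->.
Qed.

Lemma card_block E : E \in H -> #|E| = k.
Proof. by case: stH => _ cH _; exact: cH. Qed.

Lemma point_in_block x : 1 < #|V| -> exists2 E, E \in H & x \in E.
Proof.
rewrite (cardD1 x) add1n ltnS => /card_gt0P[y]; rewrite !inE => /andP[yx _].
by have [E [EH _ xE]] := block_exists yx; exists E.
Qed.

(** The block through two points of a [k]-set [E] is [E] itself: for [k = 2] those points exhaust
    both sets, and for [k = n] there is only one [k]-set. *)
Lemma steiner_complete : 1 < k -> k <= n -> k = 2 \/ k = n ->
  forall E, (E \in H) = (#|E| == k).
Proof.
move=> k1 kn kE E; apply/idP/eqP => [/card_block //|cE].
have [cV _ _] := stH.
have /card_gt1P[x [y [xE yE xy]]] : 1 < #|E| by rewrite cE.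
have [B [BH xB yB]] := block_exists xy; suff -> : E = B by [].
case: kE => [k2|k_n].
  have sub : [set x; y] \subset E by rewrite subUset !sub1set xE.
  have sub' : [set x; y] \subset B by rewrite subUset !sub1set xB.
  transitivity [set x; y]; first apply/esym; apply/eqP; rewrite eqEcard.
    by rewrite sub cards2 xy cE k2.
  by rewrite sub' cards2 xy (card_block BH) k2.
have full (A : {set V}) : #|A| = k -> A = setT.
  by move=> cA; apply/eqP; rewrite eqEcard subsetT cardsT cV cA k_n /=.
by rewrite (full E) // (full B) // card_block.
Qed.

(** * Merging a pair when blocks have more than two points *)

Section Merging.

Variables (e : {set V}).
Hypotheses (k3 : 2 < k) (e2 : #|e| = 2).

Let trace E : {set outside e} := [set z | val z \in E].

Lemma block_outside2 E : E \in H -> ~~ (e \subset E) ->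
  exists x y : outside e, [/\ val x \in E, val y \in E & x != y].
Proof.
move=> EH neE; suff /card_gt1P[x [y []]] : 1 < #|E :\: e|.
  rewrite !inE => /andP[xe xE] /andP[ye yE] xy.
  exists (Sub x xe), (Sub y ye); split; rewrite ?SubK //.
have : #|E :&: e| < 2.
  rewrite -e2; apply: proper_card; rewrite properE subsetIr subsetI subxx andbT.
  exact: neE.
rewrite cardsD (card_block EH) => lt2.
by rewrite ltn_subRL (leq_trans _ k3) // addnC ltn_add2l.
Qed.

(** A merged block still shows its points outside [e], and two of them determine it. Only blocks
    containing [e] may lack two such points, and there is just one of those. *)
Lemma merge_block_inj : {in H &, injective (fun E : {set V} => merge e @: E)}.
Proof.
move=> A B AH BH /= eqAB.
have memO (x : outside e) : (val x \in A) = (val x \in B).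
  by rewrite -!mem_merge_Some eqAB.
have [eA|/(block_outside2 AH)[x [y [xA yA xy]]]] := boolP (e \subset A).
  have [eB|/(block_outside2 BH)[x [y [xB yB xy]]]] := boolP (e \subset B).
    have /card_gt1P[i [j [ie je ij]]] : 1 < #|e| by rewrite e2.
    by apply: (block_unique ij); rewrite ?(subsetP eA) ?(subsetP eB).
  by apply: (@block_unique (val x) (val y)); rewrite ?memO.
by apply: (@block_unique (val x) (val y)); rewrite -?memO.
Qed.

Lemma mem_merge_hyper (E : {set option (outside e)}) :
  E \in merge_hyper e H <-> exists2 B, B \in H & E = merge e @: B.
Proof.
rewrite -[merge_hyper e H]/(push (merge e) H) (push_inj_in merge_block_inj).
by split=> [/imsetP|] // [B BH ->]; apply/imsetP; exists B.
Qed.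

Lemma merge_hyper_cover v :
  exists2 E : {set option (outside e)}, E \in merge_hyper e H & v \in E.
Proof.
have V1 : 1 < #|V| by rewrite -e2 max_card.
have /card_gt0P[i ie] : 0 < #|e| by rewrite e2.
have [x xv] : exists x, merge e x = v.
  by case: v => [x|]; [exists (val x); exact: merge_val | exists i; exact: merge_in].
have [B BH xB] := point_in_block x V1.
exists (merge e @: B); last by rewrite -xv imset_f.
by apply/mem_merge_hyper; exists B.
Qed.

Lemma mem_merge_hyper_None (F : {set outside e}) :
  None |: Some @: F \in merge_hyper e H <->
  exists B, [/\ B \in H, ~~ [disjoint e & B] & F = trace B].
Proof.
have memS x : (Some x \in None |: Some @: F) = (x \in F).
  by rewrite !inE /= mem_imset //; exact: Some_inj.
split=> [/mem_merge_hyper[B BH eqB]|[B [BH eB FB]]].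
  exists B; split=> //; first by rewrite -mem_merge_None -eqB setU11.
  by apply/setP => x; rewrite inE -mem_merge_Some -eqB memS.
apply/mem_merge_hyper; exists B => //; apply/setP => -[x|].
  by rewrite memS FB inE mem_merge_Some.
by rewrite mem_merge_None eB setU11.
Qed.

Lemma trace_delete B : B \in H -> [disjoint e & B] -> trace B \in delete_hyper e H.
Proof.
move=> BH dB; rewrite inE; suff -> : [set val x | x in trace B] = B by [].
apply/setP => x; apply/imsetP/idP => [[y]|xB]; first by rewrite inE => yB ->.
have xe : x \notin e by apply: contraTN xB => xe; rewrite (disjointFr dB xe).
by exists (Sub x xe); rewrite ?inE SubK.
Qed.

(** A block disjoint from [e] survives in [H_{-e}], where it cannot contain two points of [F]. *)
Lemma scattered_block F B x y : scattered (delete_hyper e H) F ->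
  x \in F -> y \in F -> x != y -> B \in H -> val x \in B -> val y \in B ->
  exists2 i, i \in e & i \in B.
Proof.
move=> scF xF yF xy BH xB yB.
have [dB|/pred0Pn[i /andP[ie iB]]] := boolP [disjoint e & B]; last by exists i.
by case/eqP: xy; apply: (scF _ _ _ (trace_delete BH dB)); rewrite ?inE.
Qed.

Lemma val_neq_in (x : outside e) i : i \in e -> i != val x.
Proof. by apply: contraTneq => ->; exact: (valP x). Qed.

(* A point z of F off B would be joined to x and to y through the point of e
   that is not on B, making the two joining blocks equal to each other and so to B. *)
Lemma scattered_sub_block F B x y : scattered (delete_hyper e H) F ->
  x \in F -> y \in F -> x != y -> B \in H -> val x \in B -> val y \in B ->
  F \subset trace B.
Proof.
move=> scF xF yF xy BH xB yB; have [i ie iB] := scattered_block scF xF yF xy BH xB yB.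
apply/subsetP => z zF; rewrite inE; apply/negPn/negP => zB.
have join w : w \in F -> val w \in B ->
    exists A p, [/\ A \in H, val w \in A, val z \in A & [/\ p \in A, p \in e & p \notin B]].
  move=> wF wB; have wz : w != z by apply: contraNneq zB => <-.
  have [A [AH wA zA]] := block_exists (wz : val w != val z).
  have [p pe pA] := scattered_block scF wF zF wz AH wA zA.
  exists A, p; split=> //; split=> //; apply/negP => pB; case/negP: zB.
  by rewrite -(block_unique (val_neq_in w pe) AH BH).
have [A [p [AH xA zA [pA pe pB]]]] := join x xF xB.
have [C [q [CH yC zC [qC qe qB]]]] := join y yF yB.
have pq : p = q.
  apply/eqP/negPn/negP => npq.
  have : #|[set i; p; q]| <= #|e|.
    by apply: subset_leq_card; rewrite !subUset !sub1set ie pe qe.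
  rewrite -setUA cardsU1 cards2 npq e2 !inE negb_or.
  suff -> : (i != p) && (i != q) by [].
  by apply/andP; split; apply: contraTneq iB => ->.
rewrite -{}pq in qC qe qB; have AC := block_unique (val_neq_in z pe) AH CH pA zA qC zC.
have AB : A = B by apply: (@block_unique (val x) (val y)); rewrite // AC.
by rewrite -AB zA in zB.
Qed.

(** The block joining [x] to another point of [F] meets [e], so it shares two points with [B]. *)
Lemma scattered_sub_full_block F B x : scattered (delete_hyper e H) F ->
  x \in F -> B \in H -> e \subset B -> val x \in B -> F \subset trace B.
Proof.
move=> scF xF BH eB xB; apply/subsetP => z zF; rewrite inE.
have [<- //|xz] := eqVneq x z.
have [A [AH xA zA]] := block_exists (xz : val x != val z).
have [p pe pA] := scattered_block scF xF zF xz AH xA zA.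
by rewrite -(block_unique (val_neq_in x pe) AH BH) // (subsetP eB).
Qed.

(** An edge of [H_{-e}] sharing two points with [B] would be [B], which meets [e]. *)
Lemma scattered_trace B : B \in H -> ~~ [disjoint e & B] ->
  scattered (delete_hyper e H) (trace B).
Proof.
move=> BH /pred0Pn[i /andP[ie iB]] A x y; rewrite !inE => AH xB yB xA yA.
apply/eqP/negPn/negP => xy.
have AB : val @: A = B.
  by apply: (block_unique (xy : val x != val y)) => //; rewrite mem_imset //; exact: val_inj.
move: iB; rewrite /= -AB => /imsetP[z _ iz].
by have := val_neq_in z ie; rewrite iz eqxx.
Qed.

(** Recovers the edges through [l_e] from [H_{-e}] alone. Traces of blocks meeting [e] are maximal
    by the two inclusion lemmas above; conversely a maximal [F] equals any such trace that contains
    it, so one containing block suffices. *)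
Lemma mem_merge_hyper_max (F : {set outside e}) :
  None |: Some @: F \in merge_hyper e H <-> max_scattered (delete_hyper e H) F.
Proof.
have /card_gt1P[i [j [ie je ij]]] : 1 < #|e| by rewrite e2.
split=> [/mem_merge_hyper_None[B [BH eB ->]]|[scF maxF]].
  split=> [|F' sF scF']; first exact: scattered_trace.
  have [sB|/(block_outside2 BH)[x [y [xB yB xy]]]] := boolP (e \subset B).
    have /subsetPn[x xB xe] : ~~ (B \subset e).
      by apply/negP => /subset_leq_card; rewrite e2 (card_block BH) leqNgt k3.
    apply: (@scattered_sub_full_block _ _ (Sub x xe)) => //; rewrite ?SubK //.
    by apply: (subsetP sF); rewrite inE SubK.
  by apply: (scattered_sub_block scF' _ _ xy) => //; apply: (subsetP sF); rewrite inE.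
apply/mem_merge_hyper_None.
suff [B [BH eB sFB]] : exists B, [/\ B \in H, ~~ [disjoint e & B] & F \subset trace B].
  exists B; split=> //; apply/eqP; rewrite eqEsubset sFB /=.
  by apply: maxF => //; exact: scattered_trace.
have meet l B : l \in e -> l \in B -> ~~ [disjoint e & B].
  by move=> le lB; apply/pred0Pn; exists l; apply/andP.
have [/card_gt1P[x [y [xF yF xy]]]|] := ltnP 1 #|F|.
  have [B [BH xB yB]] := block_exists (xy : val x != val y).
  have [l le lB] := scattered_block scF xF yF xy BH xB yB.
  exists B; split=> //; first exact: meet lB.
  exact: (scattered_sub_block scF xF yF xy BH).
(* With at most one point in [F], a block through [i] and that point, or through [i] and [j], will
   do. *)
have [->|[x xF]] := set_0Vmem F => F1.
  have [B [BH iB jB]] := block_exists ij.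
  by exists B; split; rewrite ?sub0set //; exact: meet iB.
have [B [BH iB xB]] := block_exists (val_neq_in x ie).
exists B; split=> //; first exact: meet iB.
apply/subsetP => y yF; rewrite inE; suff -> : y = x by [].
by apply/eqP; move/card_le1P: F1 => /(_ x xF y); rewrite yF inE => <-.
Qed.

(** An isomorphism invariant by which [l_e] is recognised in [H_e]. *)
Definition doubly_covered (W : finType) (K : hypergraph W) u v :=
  exists A B, [/\ A \in K, B \in K, A != B, [/\ u \in A & v \in A] &
                  [/\ u \in B & v \in B]].

Lemma doubly_covered_merge u v : u != v ->
  doubly_covered (merge_hyper e H) u v -> u = None \/ v = None.
Proof.
case: u => [x|]; last by left.
case: v => [y|]; last by right.
move=> xy [_ [_ [/mem_merge_hyper[A AH ->] /mem_merge_hyper[B BH ->] /eqP AB]]].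
rewrite !mem_merge_Some => -[xA yA] [xB yB]; case: AB.
by rewrite (block_unique (xy : val x != val y) AH BH).
Qed.

(** For [z] off the block [B] through [e], the blocks joining [z] to the two points of [e] are
    distinct and both merge to edges through [None] and [z]. Two such points are needed because one
    pair would not tell which of its ends is [l_e]. *)
Lemma doubly_covered_None : k < n -> exists x y : outside e, [/\ x != y,
  doubly_covered (merge_hyper e H) None (Some x) &
  doubly_covered (merge_hyper e H) None (Some y)].
Proof.
move=> kn; have [cV _ _] := stH.
have /card_gt1P[i [j [ie je ij]]] : 1 < #|e| by rewrite e2.
have [B [BH iB jB]] := block_exists ij.
have eB : e \subset B.
  suff <- : [set i; j] = e by rewrite subUset !sub1set iB.
  by apply/eqP; rewrite eqEcard subUset !sub1set ie je cards2 ij e2.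
have dc (z : outside e) : val z \notin B ->
    doubly_covered (merge_hyper e H) None (Some z).
  move=> zB; have [A [AH iA zA]] := block_exists (val_neq_in z ie).
  have [C [CH jC zC]] := block_exists (val_neq_in z je).
  have notdisj l (D : {set V}) : l \in e -> l \in D -> None \in merge e @: D.
    by move=> le lD; rewrite mem_merge_None; apply/pred0Pn; exists l; apply/andP.
  exists (merge e @: A), (merge e @: C); rewrite !mem_merge_Some.
  rewrite (notdisj i A) ?(notdisj j C) //.
  split=> //; try by [apply/mem_merge_hyper; exists A|apply/mem_merge_hyper; exists C].
  apply/eqP => /(merge_block_inj AH CH) AC; case/negP: zB.
  by rewrite -(block_unique ij AH BH) // AC.
have /subsetPn[x _ xB] : ~~ ([set: V] \subset B).
  by apply/negP => /subset_leq_card; rewrite cardsT cV (card_block BH) leqNgt kn.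
have ix : i != x by apply: contraNneq xB => <-.
have [A [AH iA xA]] := block_exists ix.
(* The second point is a third point of [A]; were it on [B], then [A] would be [B] and contain
   [x]. *)
have /subsetPn[y yA] : ~~ (A \subset [set i; x]).
  by apply/negP => /subset_leq_card; rewrite cards2 ix (card_block AH) leqNgt k3.
rewrite !inE negb_or => /andP[yi yx].
have yB : y \notin B.
  apply/negP => yB; case/negP: xB.
  by rewrite -(block_unique yi AH BH).
have xe : x \notin e by apply: contraNN xB; exact: subsetP.
have ye : y \notin e by apply: contraNN yB; exact: subsetP.
exists (Sub x xe), (Sub y ye); split; try by apply: dc; rewrite SubK.
by rewrite -val_eqE !SubK eq_sym.
Qed.

End Merging.

(** Extend the isomorphism by [None] to [None]: edges avoiding [None] are those of [H_{-e}], and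
    edges through it are given by maximal scattered sets, which isomorphisms preserve. *)
Lemma merge_iso_of_delete_iso e e' : 2 < k -> #|e| = 2 -> #|e'| = 2 ->
  hyper_iso (delete_hyper e H) (delete_hyper e' H) ->
  hyper_iso (merge_hyper e H) (merge_hyper e' H).
Proof.
move=> k3 e2 e'2 [psi [bpsi isoE]]; exists (omap psi).
split=> [|E]; first exact: omap_bij.
have [F [->|->]] := set_option_cases E.
  by rewrite omap_imset_Some -!mem_delete.
rewrite omap_imset_None; have mx := max_scattered_iso F bpsi isoE.
split=> [/(mem_merge_hyper_max k3 e2)/mx|/(mem_merge_hyper_max k3 e'2)/mx] mF;
  exact/mem_merge_hyper_max.
Qed.

(** If [phi] moved [None], the two doubly covered pairs would send both [Some x] and [Some y] to
    [None]. *)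
Lemma delete_iso_of_merge_iso e e' : 2 < k -> k < n -> #|e| = 2 -> #|e'| = 2 ->
  hyper_iso (merge_hyper e H) (merge_hyper e' H) ->
  hyper_iso (delete_hyper e H) (delete_hyper e' H).
Proof.
move=> k3 kn e2 e'2 [phi [bphi isoE]]; apply: (delete_iso bphi) => //.
have inj := bij_inj bphi.
have dc u v : doubly_covered (merge_hyper e H) u v ->
    doubly_covered (merge_hyper e' H) (phi u) (phi v).
  move=> [A [B [/isoE AK /isoE BK AB [uA vA] [uB vB]]]].
  exists (phi @: A), (phi @: B); rewrite !imset_f //; split=> //.
  by apply: contraNneq AB => /(imset_inj inj) ->.
have [x [y [xy /dc dx /dc dy]]] := doubly_covered_None k3 e2 kn.
have neq z : phi None != phi (Some z) by rewrite (inj_eq inj).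
have [//|phix] := doubly_covered_merge k3 e'2 (neq x) dx.
have [//|phiy] := doubly_covered_merge k3 e'2 (neq y) dy.
by have /inj/Some_inj/eqP := etrans phix (esym phiy); rewrite (negbTE xy).
Qed.

End SteinerSystem.

(** * Minors of the function of a hypergraph *)

Section Minors.

Variables (n : nat) (H : hypergraph 'I_n).
Hypothesis n2 : 1 < n.
Hypothesis coverH : forall x, exists2 E : {set 'I_n}, E \in H & x \in E.
Implicit Type e : {set 'I_n}.

Lemma hyper_fun_ffun b : hyper_fun H [ffun i => b i] = hypergraph_fun H b.
Proof. by rewrite hyper_funE; apply: eq_hypergraph_fun => i; rewrite ffunE. Qed.

Lemma push_cover_surj (V W : finType) (K : hypergraph V) (rho : V -> W) v :
  (exists2 E : {set W}, E \in push rho K & v \in E) -> exists x, rho x = v.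
Proof. by case=> _ /push_edge[F _ ->] /imsetP[x _ ->]; exists x. Qed.

Lemma card_codom_surj (V W : finType) (f : V -> W) :
  (forall v, exists x, f x = v) -> #|codom f| = #|W|.
Proof. by move=> surj; apply: eq_card => v; have [x <-] := surj v; rewrite codom_f. Qed.

Lemma merge_factor (V : finType) (W : Type) (tau : V -> W) i j : tau i = tau j ->
  exists tau' : option (outside [set i; j]) -> W, tau =1 tau' \o merge [set i; j].
Proof.
move=> tij; exists (fun o => if o is Some x then tau (val x) else tau i) => x /=.
case xe: (x \in [set i; j]).
  by rewrite merge_in //; case/set2P: xe => ->.
have -> : x = val (Sub x (negbT xe) : outside [set i; j]) by rewrite SubK.
by rewrite merge_val.
Qed.

Lemma strict_minor_collapse m (f : boolfun n) (g : boolfun m) (tau : 'I_n -> 'I_m) :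
  (forall a, g a = f [ffun i => a (tau i)]) -> ~ minor f g ->
  exists i j, i != j /\ tau i = tau j.
Proof.
move=> gE ngf; have [/injectiveP inj|] := boolP (injectiveb tau); last first.
  by case/injectivePn=> i [j ij tij]; exists i, j.
case: ngf; pose i0 := Ordinal (ltnW n2).
(* A left inverse of the injective [tau], with the arbitrary value [i0] off its image. *)
exists (fun y => odflt i0 [pick x | tau x == y]) => a.
rewrite gE; congr f; apply/ffunP => i; rewrite !ffunE.
by case: pickP => [x /eqP/inj ->//|/(_ i)]; rewrite eqxx.
Qed.

(** This is [f_{H_e}], with [V_e] numbered by [enum_rank] because variables are ordinals. *)
Definition merge_fun e : boolfun #|{: option (outside e)}| :=
  fun a => hyper_fun H [ffun i => a (enum_rank (merge e i))].
Arguments merge_fun : clear implicits.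

Lemma merge_funE e a :
  merge_fun e a = hypergraph_fun (merge_hyper e H) (a \o enum_rank).
Proof. by rewrite [RHS]hypergraph_fun_push -hyper_fun_ffun. Qed.

(** Otherwise some [rho] factoring through the [n - 1] vertices of [H_e] would push [H] to itself,
    and so be onto the [n] vertices because edges cover them. *)
Lemma merge_fun_strict e : #|e| = 2 -> strict_minor (merge_fun e) (hyper_fun H).
Proof.
move=> e2; split; first by exists (fun i => enum_rank (merge e i)).
case=> sigma sE; pose rho i := sigma (enum_rank (merge e i)).
have rhoH : push rho H = H.
  apply: hypergraph_fun_inj => a; rewrite hypergraph_fun_push.
  have := sE [ffun i => a i]; rewrite /merge_fun hyper_fun_ffun => ->.
  by rewrite hyper_fun_ffun; apply: eq_hypergraph_fun => i; rewrite !ffunE.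
have surj v : exists x, rho x = v by apply: (@push_cover_surj _ _ H); rewrite rhoH.
have : #|'I_n| <= #|{: option (outside e)}|.
  rewrite -(card_codom_surj (f := sigma)) => [|v].
    by rewrite -[X in _ <= X]card_ord; exact: leq_image_card.
  by have [x <-] := surj v; exists (enum_rank (merge e x)).
by rewrite card_option_outside // card_ord -ltnS prednK ?ltnn // ltnW.
Qed.

Lemma join_irreducible_of_merge_iso :
  (forall e e', #|e| = 2 -> #|e'| = 2 ->
     hyper_iso (merge_hyper e H) (merge_hyper e' H)) ->
  join_irreducible (hyper_fun H).
Proof.
move=> isoM; pose i0 := Ordinal (ltnW n2); pose i1 := Ordinal n2.
pose e0 := [set i0; i1]; have e02 : #|e0| = 2 by rewrite cards2.
exists _, (merge_fun e0); split; first by rewrite card_option.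
  exact: merge_fun_strict.
move=> p g p0 [[tau gE] ngf].
have [i [j [ij tij]]] := strict_minor_collapse gE ngf.
have [tau' tauE] := merge_factor tij.
have ij2 : #|[set i; j]| = 2 by rewrite cards2 ij.
have /hyper_isoP[phi _ phiE] := isoM _ _ e02 ij2.
exists (fun y => tau' (phi (enum_val y))) => a.
rewrite gE (hyper_fun_ffun (fun i => a (tau i))).
rewrite (eq_hypergraph_fun _ (b := (a \o tau') \o merge [set i; j])); last first.
  by move=> x /=; rewrite tauE.
rewrite -hypergraph_fun_push -[push _ H]/(merge_hyper _ H) -phiE hypergraph_fun_push.
rewrite merge_funE; apply: eq_hypergraph_fun => x /=.
by rewrite ffunE enum_rankK.
Qed.

(** The largest strict minor identifies some [i] and [j], so every [f_{H_e}] is a minor of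
    [f_{H_{ij}}]. The map realising this is onto since edges cover [H_e], hence bijective as both
    vertex sets have [n - 1] elements. *)
Lemma merge_iso_of_join_irreducible :
  (forall e, #|e| = 2 -> forall v,
     exists2 E : {set option (outside e)}, E \in merge_hyper e H & v \in E) ->
  join_irreducible (hyper_fun H) ->
  forall e e', #|e| = 2 -> #|e'| = 2 ->
    hyper_iso (merge_hyper e H) (merge_hyper e' H).
Proof.
move=> coverM [m [f' [_ [[tau f'E] nf'] max']]].
have [i [j [ij tij]]] := strict_minor_collapse f'E nf'.
have ij2 : #|[set i; j]| = 2 by rewrite cards2 ij.
suff iso0 e : #|e| = 2 -> hyper_iso (merge_hyper [set i; j] H) (merge_hyper e H).
  move=> e e' /iso0 isoe /iso0 isoe'.
  exact: hyper_iso_trans (hyper_iso_sym isoe) isoe'.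
move=> e2; have M0 : 0 < #|{: option (outside e)}| by rewrite card_option.
have [sigma sE] := max' _ _ M0 (merge_fun_strict e2).
pose rho x := enum_val (sigma (tau x)).
have rij : rho i = rho j by rewrite /rho tij.
have [rho' rhoE] := merge_factor rij.
have pushE : push rho' (merge_hyper [set i; j] H) = merge_hyper e H.
  rewrite -[merge_hyper [set _; _] H]/(push (merge _) H) -push_comp -(eq_push _ rhoE).
  apply: hypergraph_fun_inj => a; rewrite hypergraph_fun_push.
  transitivity (merge_fun e [ffun y => a (enum_val y)]).
    rewrite sE f'E (hyper_fun_ffun (fun x => _ (tau x))).
    by apply: eq_hypergraph_fun => x; rewrite /= !ffunE.
  by rewrite merge_funE; apply: eq_hypergraph_fun => x; rewrite /= ffunE enum_rankK.
have surj v : exists x, rho' x = v.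
  by apply: (@push_cover_surj _ _ (merge_hyper [set i; j] H)); rewrite pushE; exact: coverM.
apply/hyper_isoP; exists rho' => //.
apply: inj_card_bij; last by rewrite !card_option_outside.
suff inj : {in predT &, injective rho'} by move=> x y; exact: inj.
apply/image_injP/eqP/(etrans (card_codom_surj surj)).
by rewrite !card_option_outside.
Qed.

End Minors.

Theorem theorem3p10 (n k : nat) (H : {set {set 'I_n}})
    (hk : 2 <= k) (hkn : k <= n) (hH : steiner_system n k H) :
  (join_irreducible (hyper_fun H) <->
     (forall e e' : {set 'I_n}, #|e| = 2 -> #|e'| = 2 ->
        hyper_iso (merge_hyper e H) (merge_hyper e' H))) /\
  ((forall e e' : {set 'I_n}, #|e| = 2 -> #|e'| = 2 ->
      hyper_iso (merge_hyper e H) (merge_hyper e' H)) <->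
     minus2_monomorphic H).
Proof.
have n2 : 1 < n by exact: leq_trans hkn.
have coverH x : exists2 E : {set 'I_n}, E \in H & x \in E.
  by apply: (point_in_block hH); rewrite card_ord.
have ji := join_irreducible_of_merge_iso n2 coverH.
(* Merged blocks may cancel when [k = 2], and [l_e] is not recognisable when [k = n]; full symmetry
   then gives (ii) and (iii) outright, and (i) follows from (ii). *)
have [deg|/norP[k2 kn]] := boolP ((k == 2) || (k == n)).
  have symH (s : {perm 'I_n}) (E : {set 'I_n}) : (s @: E \in H) = (E \in H).
    have kE : k = 2 \/ k = n by case/orP: deg => /eqP; [left|right].
    by rewrite !(steiner_complete hH hk hkn kE) card_imset //; exact: perm_inj.
  have isoM (e e' : {set 'I_n}) : #|e| = 2 -> #|e'| = 2 ->
      hyper_iso (merge_hyper e H) (merge_hyper e' H).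
    by move=> e2 e'2; have [] := symmetric_iso symH e2 e'2.
  split; split=> // _ e e' e2 e'2.
  by have [] := symmetric_iso symH e2 e'2.
have k3 : 2 < k by rewrite ltn_neqAle eq_sym k2.
have {}kn : k < n by rewrite ltn_neqAle kn.
split; split=> //.
- apply: merge_iso_of_join_irreducible n2 coverH _.
  by move=> e e2 v; exact: (merge_hyper_cover hH k3 e2).
- by move=> isoM e e' e2 e'2; apply: (delete_iso_of_merge_iso hH) => //; exact: isoM.
- by move=> isoD e e' e2 e'2; apply: (merge_iso_of_delete_iso hH) => //; exact: isoD.
Qed.
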